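(* Let $V$ be an infinite-dimensional complex inner product space and let $V^* \subset V'$ be the subspace of all bounded antilinear functionals on $V$, with operator norm $\|\bullet\|$. Then for all $\xi, \eta \in V^*$ the partial inner product $$[\xi | \eta] = \lim_{M \uparrow \mathcal{F}(V)} \langle \xi_M | \eta_M \rangle$$ is defined (the limit exists) and satisfies $$4[\xi | \eta] = \sum_{n=0}^{3} i^{-n} \|\xi + i^n \eta\|^2;$$ on $V^*$ it is a true inner product whose associated norm is the operator norm. Moreover, for each $\zeta \in V^*$ the net $(\zeta_M' : M \in \mathcal{F}(V))$ converges to $\zeta$ in operator norm, and $V^*$ with this inner product, together with the embedding $V \to V^*$, $v \mapsto v'$, is a Hilbert space completion of $V$.
   Context: The inner product $\langle \bullet | \bullet \rangle$ on $V$ is antilinear in the first slot and linear in the second; no completeness of $V$ is assumed. The full antidual $V'$ is the complex vector space of all antilinear maps $V \to \mathbb{C}$, bounded or not. For $v \in V$, $v' \in V'$ is defined by $v'(z) = \langle z | v \rangle$ for all $z \in V$. $\mathcal{F}(V)$ is the set of all finite-dimensional complex subspaces of $V$, directed by inclusion. For $\zeta \in V'$ and $M \in \mathcal{F}(V)$, $\zeta_M \in M$ is the unique vector such that $\zeta(z) = \langle z | \zeta_M \rangle$ for all $z \in M$; and $\zeta_M' := (\zeta_M)' \in V'$. The operator norm of $\zeta \in V^*$ is $\|\zeta\| = \sup\{|\zeta(z)| : z \in V, \|z\| \leqslant 1\}$. *)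

(* Defs.v *)
From HB Require Import structures.
From mathcomp Require Import all_boot all_order all_algebra.
From mathcomp Require Import all_classical all_reals all_analysis.
From mathcomp Require Import sesquilinear complex.

Set Implicit Arguments.
Unset Strict Implicit.
Unset Printing Implicit Defensive.

Import Order.TTheory GRing.Theory Num.Theory Num.Def.
Import numFieldNormedType.Exports.

Local Open Scope classical_set_scope.
Local Open Scope complex_scope.
Local Open Scope ring_scope.

Section InnerProduct.
Context {R : realType} {V : lmodType R[i]}.
Implicit Types d : {dot V for conjC}.

(* The forms of [{dot V for conjC}] are linear in the first argument and
   antilinear in the second; exchanging the arguments gives the bracket
   <u | v>, antilinear in u and linear in v. *)
Definition braket d (u v : V) : R[i] := d v u.

Definition ipnorm d (v : V) : R := Num.sqrt (complex.Re (braket d v v)).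

Lemma braketDl d u v w : braket d (u + v) w = braket d u w + braket d v w.
Proof. by rewrite /braket linearDr. Qed.

Lemma braketDr d u v w : braket d w (u + v) = braket d w u + braket d w v.
Proof. by rewrite /braket linearDl. Qed.

Lemma braketBr d u v w : braket d w (u - v) = braket d w u - braket d w v.
Proof. by rewrite /braket linearBl. Qed.

Lemma braketZl d a u w : braket d (a *: u) w = a^* * braket d u w.
Proof. by rewrite /braket linearZr_LR. Qed.

Lemma braketZr d a u w : braket d w (a *: u) = a * braket d w u.
Proof. by rewrite /braket linearZl_LR. Qed.

Lemma braketC d u v : braket d u v = (braket d v u)^*.
Proof. by rewrite /braket hermC mul1r. Qed.

Lemma braket_ge0 d u : 0 <= braket d u u.
Proof. exact: dnorm_ge0. Qed.


Lemma ipnorm_ge0 d u : 0 <= ipnorm d u.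
Proof. exact: sqrtr_ge0. Qed.

Lemma ipnormE d u : (ipnorm d u)%:C ^+ 2 = braket d u u.
Proof.
have := braket_ge0 d u; rewrite /ipnorm; case: (braket d u u) => a b.
rewrite lecE /= => /andP[/eqP -> a0].
by rewrite -rmorphXn /= sqr_sqrtr.
Qed.

Lemma ipnormZ d a u : ipnorm d (a *: u) = Normc.normc a * ipnorm d u.
Proof.
apply: (@complexI R); apply/eqP; rewrite -(eqrXn2 (n := 2)) //; last 2 first.
- by rewrite ler0c ipnorm_ge0.
- by rewrite ler0c mulr_ge0 ?ipnorm_ge0 //; case: a => x y; exact: sqrtr_ge0.
rewrite ipnormE braketZl braketZr mulrA [_^* * _]mulrC -normCK.
by rewrite rmorphM exprMn ipnormE.
Qed.

Lemma normc_ge0 (x : R[i]) : 0 <= Normc.normc x.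
Proof. by case: x => x y; exact: sqrtr_ge0. Qed.

Lemma normc_conj (x : R[i]) : Normc.normc x^* = Normc.normc x.
Proof. by apply: (@complexI R); exact: norm_conjC. Qed.

Lemma braket_CauchySchwarz d u v :
  Normc.normc (braket d u v) <= ipnorm d u * ipnorm d v.
Proof.
rewrite -(lecR (Normc.normc _)) rmorphM /=.
rewrite -(@ler_pXn2r _ 2) ?nnegrE ?mulr_ge0 ?ler0c ?ipnorm_ge0 ?normc_ge0 //.
rewrite exprMn !ipnormE.
have -> : (Normc.normc (braket d u v))%:C = `|braket d u v| by [].
have [->|v0] := eqVneq v 0.
  by rewrite /braket linear0l normr0 expr0n /= linear0l mulr0.
have vv : 0 < braket d v v by rewrite /braket dnorm_gt0.
set b := braket d v v in vv *; set t := braket d u v.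
have := braket_ge0 d (u - (t^* / b) *: v).
have tC : braket d v u = t^* by rewrite braketC.
have bC : b^* = b by rewrite /b -braketC.
rewrite -scaleNr braketDl !braketDr !braketZl !braketZr -/b -/t tC.
rewrite !rmorphN !rmorphM !fmorphV /= !bC conjCK.
rewrite [- (t^* / b) * b]mulNr divfK ?gt_eqF // mulrN subrr addr0 mulNr.
by rewrite subr_ge0 -mulrAC ler_pdivrMr // [_^* * _]mulrC -normCK.
Qed.

End InnerProduct.

Section Subspaces.
Context {R : realType} {V : lmodType R[i]}.

Definition lspan (s : seq V) : set V :=
  [set v | exists c : 'I_(size s) -> R[i], v = \sum_i c i *: s`_i].

Definition finite_dim_subspace (M : set V) : Prop :=
  GRing.submod_closed (mem M) /\ exists s : seq V, M = lspan s.

Lemma lspan_nil : lspan [::] = [set 0].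
Proof.
apply/seteqP; split => [v [c ->]|v ->] /=; first by rewrite big_ord0.
by exists (fun=> 0); rewrite big_ord0.
Qed.

Lemma lspan_cons x s v :
  lspan (x :: s) v <-> exists a w, lspan s w /\ v = a *: x + w.
Proof.
split=> [[c ->]|[a [w [[c ->] ->]]]].
  exists (c ord0), (\sum_(i < size s) c (lift ord0 i) *: s`_i).
  by split; [exists (fun i => c (lift ord0 i)) | rewrite big_ord_recl].
exists (fun i => if unlift ord0 i is Some j then c j else a).
rewrite big_ord_recl unlift_none; congr (_ + _).
by apply: eq_bigr => i _; rewrite liftK.
Qed.

Lemma lspan_closed s : GRing.submod_closed (mem (lspan s)).
Proof.
split=> [|a u v]; first by apply/mem_set; exists (fun=> 0);
  rewrite big1 // => i _; rewrite scale0r.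
move=> /set_mem[c ->] /set_mem[e ->]; apply/mem_set.
exists (fun i => a * c i + e i); rewrite scaler_sumr -big_split /=.
by apply: eq_bigr => i _; rewrite scalerDl scalerA.
Qed.

Lemma lspan_cat s t v :
  lspan (s ++ t) v <-> exists u w, [/\ lspan s u, lspan t w & v = u + w].
Proof.
elim: s v => [|x s IH] v /=.
  rewrite lspan_nil; split=> [tv|[u [w [/= -> tw ->]]]]; last by rewrite add0r.
  by exists 0, v; rewrite add0r.
split=> [/lspan_cons[a [y [/IH[u [w [su tw ->]]] ->]]]|].
  exists (a *: x + u), w; split=> //; last by rewrite addrA.
  by apply/lspan_cons; exists a, u.
move=> [_ [w [/lspan_cons[a [u [su ->]]] tw ->]]].
apply/lspan_cons; exists a, (u + w); split; last by rewrite addrA.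
by apply/IH; exists u, w.
Qed.

End Subspaces.

Definition infinite_dimensional {R : realType} (V : lmodType R[i]) : Prop :=
  ~ finite_dim_subspace [set: V].

Record fdsub {R : realType} (V : lmodType R[i]) := FDSub {
  fdsub_set : set V;
  fdsubP : finite_dim_subspace fdsub_set
}.

(* A net indexed by the finite-dimensional subspaces of V, directed by
   inclusion, converges to l iff its image under this filter does. *)
Definition fdsub_up {R : realType} (V : lmodType R[i]) : set_system (fdsub V) :=
  filter_from [set: fdsub V] (fun M => [set N : fdsub V | fdsub_set M `<=` fdsub_set N]).
Arguments fdsub_up {R} V.

Global Instance fdsub_up_proper {R : realType} (V : lmodType R[i]) :
  ProperFilter (fdsub_up V).
Proof.
apply: filter_from_proper => [|M _]; last by exists M.
have P0 : finite_dim_subspace (lspan [::] : set V).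
  by split; [exact: lspan_closed | exists [::]].
apply: filter_from_filter; first by exists (FDSub P0).
move=> [M PM] [N PN] _ _; have [_ [s Ms]] := PM; have [_ [t Nt]] := PN.
have Pst : finite_dim_subspace (lspan (s ++ t)).
  by split; [exact: lspan_closed | exists (s ++ t)].
exists (FDSub Pst) => //= K stK; split=> /= v; rewrite ?Ms ?Nt => sv.
- apply/stK/lspan_cat; exists v, 0; split=> //; last by rewrite addr0.
  by have [/set_mem] := lspan_closed t.
- apply/stK/lspan_cat; exists 0, v; split=> //; last by rewrite add0r.
  by have [/set_mem] := lspan_closed s.
Qed.

Section Antidual.
Context {R : realType} {V : lmodType R[i]}.

Definition antilinear (f : V -> R[i]) : Prop :=
  forall a u v, f (a *: u + v) = a^* * f u + f v.

Definition antilinear_pred : {pred V -> R[i]} := fun f => `[< antilinear f >].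

Lemma antilinear_submod : GRing.submod_closed antilinear_pred.
Proof.
split=> [|c f g /asboolP fA /asboolP gA]; apply/asboolP => a u v.
  by rewrite /= mulr0 addr0.
by rewrite /= !fctE fA gA /GRing.scale /= !mulrDr mulrCA addrACA.
Qed.

HB.instance Definition _ :=
  GRing.isSubmodClosed.Build _ _ antilinear_pred antilinear_submod.

End Antidual.

Record antidual {R : realType} (V : lmodType R[i]) := Antidual {
  antidual_fun :> V -> R[i];
  antidual_funP : antidual_fun \in antilinear_pred
}.

Section AntidualLmod.
Context {R : realType} {V : lmodType R[i]}.
HB.instance Definition _ := [isSub for @antidual_fun R V].
HB.instance Definition _ := [Choice of antidual V by <:].
HB.instance Definition _ := [SubChoice_isSubLmodule of antidual V by <:].
End AntidualLmod.

Section PartialInnerProduct.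
Context {R : realType} {V : lmodType R[i]} (d : {dot V for conjC}).
Implicit Types (zeta xi eta : antidual V) (M : fdsub V) (v : V).

Lemma antidualE zeta : antilinear zeta.
Proof. by have /asboolP := antidual_funP zeta. Qed.

Lemma antidual0 zeta : zeta 0 = 0.
Proof.
have := antidualE zeta 1 0 0; rewrite scaler0 addr0 rmorph1 mul1r.
by move/(congr1 (fun x => x - zeta 0)); rewrite subrr addrK.
Qed.

Lemma antidualD zeta u v : zeta (u + v) = zeta u + zeta v.
Proof. by rewrite -[u]scale1r antidualE rmorph1 mul1r scale1r. Qed.

Lemma antidualZ zeta a v : zeta (a *: v) = a^* * zeta v.
Proof. by rewrite -[_ *: _]addr0 antidualE antidual0 addr0. Qed.

(* The vector zeta_M of M representing the restriction of zeta to M. *)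
Definition riesz zeta M : V :=
  xget 0 [set w | fdsub_set M w /\ forall z, fdsub_set M z -> zeta z = braket d z w].

Lemma riesz_exists zeta (s : seq V) :
  exists w, lspan s w /\ forall z, lspan s z -> zeta z = braket d z w.
Proof.
elim: s zeta => [|x s IH] zeta.
  exists 0; rewrite lspan_nil; split=> // _ ->.
  by rewrite antidual0 /braket linear0l.
have xA : antilinear (fun z => braket d z x).
  by move=> a u v; rewrite braketDl braketZl.
have [p [sp px]] := IH (Antidual (asboolT xA)).
have [w [sw wz]] := IH zeta.
pose y := x - p; pose c := zeta y / braket d y y.
have yz z : lspan s z -> braket d z y = 0.
  by move=> /px /= e; rewrite /y braketBr e subrr.
have [_ sL] := lspan_closed s.
have sP a u v : lspan s u -> lspan s v -> lspan s (a *: u + v).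
  by move=> /mem_set su /mem_set sv; apply/set_mem/sL.
exists (w + c *: y); split.
  apply/lspan_cons; exists c, (- c *: p + w); split; first exact: sP.
  by rewrite /y scalerBr scaleNr addrC addrA.
move=> z /lspan_cons[a [u [su ->]]].
have -> : a *: x + u = (a *: p + u) + a *: y.
  by rewrite /y scalerBr addrAC [a *: p + _]addrC subrK.
have := sP a _ _ sp su; move: (a *: p + u) => q su'.
rewrite antidualD (wz _ su') antidualZ braketDl !braketDr !braketZr !braketZl.
rewrite (yz _ su') mulr0 addr0 [braket d y w]braketC (yz _ sw) rmorph0 mulr0.
rewrite add0r; congr (_ + _); rewrite mulrCA /c; congr (_ * _).
have [y0|yN0] := eqVneq (braket d y y) 0; last by rewrite divfK.
by move/eqP: y0; rewrite /braket dnorm_eq0 => /eqP ->; rewrite antidual0 !mul0r.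
Qed.

Lemma rieszP zeta M :
  fdsub_set M (riesz zeta M) /\
  forall z, fdsub_set M z -> zeta z = braket d z (riesz zeta M).
Proof.
have [_ [s Ms]] := fdsubP M; have [w [sw wz]] := riesz_exists zeta s.
by rewrite /riesz; case: xgetP => [u _ //|/(_ w)[]]; rewrite Ms.
Qed.

Lemma riesz_unique zeta M w :
  fdsub_set M w -> (forall z, fdsub_set M z -> zeta z = braket d z w) -> w = riesz zeta M.
Proof.
move=> Mw wz; have [Mr rz] := rieszP zeta M; have [[_ ML] _] := fdsubP M.
have Mb : fdsub_set M (w - riesz zeta M).
  by rewrite addrC -scaleN1r; apply/set_mem/ML; apply/mem_set.
apply/eqP; rewrite -subr_eq0 -(dnorm_eq0 d).
set b := w - _ in Mb *; have := wz _ Mb; rewrite (rz _ Mb) => e.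
by rewrite -/(braket d b b) {2}/b braketBr e subrr.
Qed.

Definition pip_net xi eta M : R[i]^o := braket d (riesz xi M) (riesz eta M).

Definition pip_defined xi eta : Prop := cvg (pip_net xi eta @ fdsub_up V).

(* Meaningful only when [pip_defined xi eta]. *)
Definition pip xi eta : R[i] := lim (pip_net xi eta @ fdsub_up V).

Lemma antidual_of_subproof v : (fun z => braket d z v) \in antilinear_pred.
Proof. by apply/asboolP => a u w; rewrite braketDl braketZl. Qed.

Definition antidual_of v : antidual V := Antidual (antidual_of_subproof v).

Definition bounded_pred : {pred antidual V} := fun zeta =>
  `[< exists B : R, forall z, Normc.normc (zeta z) <= B * ipnorm d z >].

Lemma bounded_submod : GRing.submod_closed bounded_pred.
Proof.
split=> [|c f g /asboolP[A fA] /asboolP[B gB]]; apply/asboolP.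
  by exists 0 => z; rewrite [X in Normc.normc X](_ : _ = 0) // Normc.normc0 mul0r.
exists (Normc.normc c * A + B) => z.
rewrite [X in Normc.normc X](_ : _ = c * f z + g z) //.
rewrite mulrDl (le_trans (le_normcD _ _)) // lerD // Normc.normcM -mulrA.
by rewrite ler_wpM2l // normc_ge0.
Qed.

HB.instance Definition _ :=
  GRing.isSubmodClosed.Build _ _ bounded_pred bounded_submod.

End PartialInnerProduct.

Record bdual {R : realType} {V : lmodType R[i]} (d : {dot V for conjC}) :=
  Bdual {
    bdual_antidual :> antidual V;
    bdualP : bdual_antidual \in bounded_pred d
  }.

Section BoundedAntidual.
Context {R : realType} {V : lmodType R[i]} (d : {dot V for conjC}).

HB.instance Definition _ := [isSub for @bdual_antidual R V d].
HB.instance Definition _ := [Choice of bdual d by <:].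
HB.instance Definition _ := [SubChoice_isSubLmodule of bdual d by <:].

Lemma bdual_of_subproof v : antidual_of d v \in bounded_pred d.
Proof.
apply/asboolP; exists (ipnorm d v) => z.
by rewrite mulrC; exact: braket_CauchySchwarz.
Qed.

Definition bdual_of (v : V) : bdual d := Bdual (bdual_of_subproof v).

Definition opnorm (zeta : bdual d) : R :=
  sup [set Normc.normc (zeta z) | z in [set z | ipnorm d z <= 1]].

Lemma opnorm_has_sup (zeta : bdual d) :
  has_sup [set Normc.normc (zeta z) | z in [set z | ipnorm d z <= 1]].
Proof.
split.
  exists (Normc.normc (zeta 0)); exists 0 => //=.
  by rewrite /ipnorm /braket linear0l sqrtr0.
have /asboolP[B zB] := bdualP zeta; exists `|B| => _ [z /= z1 <-].
rewrite (le_trans (zB z)) // (le_trans (ler_norm _)) // normrM.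
by rewrite ler_piMr // ger0_norm // ipnorm_ge0.
Qed.

Lemma opnorm_ge (zeta : bdual d) z :
  Normc.normc (zeta z) <= opnorm zeta * ipnorm d z.
Proof.
have [z0|z0] := eqVneq (ipnorm d z) 0.
  have /asboolP[B /(_ z)] := bdualP zeta.
  by rewrite z0 !mulr0.
have zp : 0 < ipnorm d z by rewrite lt_def z0 ipnorm_ge0.
rewrite -ler_pdivrMr //.
have nz : Normc.normc ((ipnorm d z)^-1%:C) = (ipnorm d z)^-1.
  by rewrite /= expr0n addr0 sqrtr_sqr ger0_norm // invr_ge0 ltW.
apply: sup_upper_bound; first exact: opnorm_has_sup.
exists ((ipnorm d z)^-1%:C *: z) => /=; first by rewrite ipnormZ nz mulVf.
by rewrite antidualZ Normc.normcM mulrC normc_conj nz.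
Qed.

Lemma opnorm_le (zeta : bdual d) (B : R) :
  (forall z, ipnorm d z <= 1 -> Normc.normc (zeta z) <= B) -> opnorm zeta <= B.
Proof.
move=> zB; apply: ge_sup; first by case: (opnorm_has_sup zeta).
by move=> _ [z /= z1 <-]; exact: zB.
Qed.

Lemma opnorm_ge1 (zeta : bdual d) z :
  ipnorm d z <= 1 -> Normc.normc (zeta z) <= opnorm zeta.
Proof.
by move=> z1; apply: sup_upper_bound; [exact: opnorm_has_sup | exists z].
Qed.

Lemma opnorm_ge0 (zeta : bdual d) : 0 <= opnorm zeta.
Proof.
apply: le_trans (opnorm_ge1 (z := 0) zeta _); first exact: normc_ge0.
by rewrite /ipnorm /braket linear0l sqrtr0.
Qed.

Lemma opnormD (xi eta : bdual d) : opnorm (xi + eta) <= opnorm xi + opnorm eta.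
Proof.
apply: opnorm_le => z z1; rewrite (le_trans (le_normcD _ _)) //.
by rewrite lerD // opnorm_ge1.
Qed.

Lemma opnormZ_le (a : R[i]) (zeta : bdual d) :
  opnorm (a *: zeta) <= Normc.normc a * opnorm zeta.
Proof.
apply: opnorm_le => z z1; rewrite [X in Normc.normc X](_ : _ = a * zeta z) //.
by rewrite Normc.normcM ler_wpM2l ?normc_ge0 // opnorm_ge1.
Qed.

Lemma opnormZ (a : R[i]) (zeta : bdual d) :
  opnorm (a *: zeta) = Normc.normc a * opnorm zeta.
Proof.
apply/le_anti; rewrite opnormZ_le /=; have [->|a0] := eqVneq a 0.
  by rewrite Normc.normc0 mul0r opnorm_ge0.
have na0 : Normc.normc a != 0.
  by apply: contra a0 => /eqP/Normc.eq0_normc ->.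
have na : 0 < Normc.normc a by rewrite lt_def na0 normc_ge0.
rewrite -ler_pdivlMl // -Normc.normcV.
by rewrite -{1}(scalerK a0 zeta) opnormZ_le.
Qed.

Lemma opnorm_eq0 (zeta : bdual d) : opnorm zeta = 0 -> zeta = 0.
Proof.
move=> z0; do 2!apply: val_inj; apply/funext => z /=.
have := opnorm_ge zeta z; rewrite z0 mul0r => zz.
by apply: Normc.eq0_normc; apply/le_anti; rewrite zz normc_ge0.
Qed.

(* The norm takes its values in the scalar field R[i]. *)
Definition bdual_norm (zeta : bdual d) : R[i] := (opnorm zeta)%:C.

Lemma bdual_normD (xi eta : bdual d) :
  bdual_norm (xi + eta) <= bdual_norm xi + bdual_norm eta.
Proof. by rewrite /bdual_norm -rmorphD lecR opnormD. Qed.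

Lemma bdual_normZ (a : R[i]) (zeta : bdual d) :
  bdual_norm (a *: zeta) = `|a| * bdual_norm zeta.
Proof. by rewrite /bdual_norm opnormZ rmorphM. Qed.

Lemma bdual_norm_eq0 (zeta : bdual d) : bdual_norm zeta = 0 -> zeta = 0.
Proof. by move/(@complexI R); exact: opnorm_eq0. Qed.

HB.instance Definition _ := Lmodule_isNormed.Build R[i] (bdual d)
  bdual_normD bdual_normZ bdual_norm_eq0.

Lemma bdual_normE (zeta : bdual d) : `|zeta| = (opnorm zeta)%:C.
Proof. by []. Qed.

End BoundedAntidual.

Definition hilbert_completion {R : realType} {V : lmodType R[i]}
    (d : {dot V for conjC}) (H : normedModType R[i]) (D : {dot H for conjC})
    (j : V -> H) : Prop :=
  [/\ forall x : H, `|x| = (ipnorm D x)%:C,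
      forall F : set_system H, ProperFilter F -> cauchy F -> cvg F,
      linear j,
      forall u v, braket D (j u) (j v) = braket d u v
    & dense (range j)].

(* Main.v *)
From HB Require Import structures.
Require Import Defs.
From mathcomp Require Import all_boot all_order all_algebra.
From mathcomp Require Import all_classical all_reals all_analysis.
From mathcomp Require Import sesquilinear complex ring.

Set Implicit Arguments.
Unset Strict Implicit.
Unset Printing Implicit Defensive.

Import Order.TTheory GRing.Theory Num.Theory Num.Def.
Import numFieldNormedType.Exports.

Local Open Scope classical_set_scope.
Local Open Scope complex_scope.
Local Open Scope ring_scope.

(** Everything rests on the vectors [riesz d zeta M], which behave like the
    orthogonal projections onto the finite-dimensional subspaces [M] of a vector
    that need not exist in [V]. For [M] contained in [N], the vector for [M] is
    the orthogonal projection on [M] of the vector for [N]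
    ([riesz_pythagoras]). Hence the norms of these vectors increase with [M];
    they are bounded by the operator norm of [zeta], and they reach it in the
    limit because every [z] in the unit ball belongs to some [M], on which
    Cauchy-Schwarz bounds [zeta z] by the norm of the vector
    ([ipnorm_riesz_cvg]). The same orthogonality gives
    [opnorm (zeta - zeta_M') ^ 2 <= opnorm zeta ^ 2 - ipnorm zeta_M ^ 2]
    ([opnorm_sub_riesz]), so that [zeta_M'] tends to [zeta] in operator norm
    ([riesz_cvg]).

    The map [zeta |-> zeta_M] is linear, so the polarization identity of [V]
    writes [<xi_M | eta_M>] through the norms of the vectors
    [(xi + i^n eta)_M], each of which converges. Thus the limit exists and
    satisfies the polarization identity for the operator norm
    ([pip_net_cvg]). Sesquilinearity and symmetry pass to the limit, and
    [pip zeta zeta] is the square of the operator norm, which gives definiteness.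

    Completeness of the bounded antidual is that of any space of bounded maps
    into a complete space: a Cauchy filter converges pointwise, and the
    Cauchy estimate is preserved by the pointwise limit ([bdual_complete]).
    The image of [V] is dense because it contains the functionals [zeta_M'],
    which converge to [zeta]. *)

(** * Limits in the complex numbers *)

Section ComplexLimits.
Context {R : realType}.

(** The radii of a normed module over [R[i]] are complex; an inequality with a
    complex number forces its imaginary part, so real radii suffice. *)
Lemma cvg_realP (W : normedModType R[i]) (T : Type) (F : set_system T)
    {FF : Filter F} (f : T -> W) (l : W) :
  f @ F --> l <-> forall e : R, 0 < e -> \forall x \near F, `|l - f x| <= e%:C.
Proof.
split=> [fl e e0|fl].
  by move/cvgrPdist_le : fl; apply; rewrite ltcR.
apply/cvgrPdist_le => e; case: e => a b; rewrite ltcE /= => /andP[/eqP-> a0].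
exact: fl.
Qed.

Lemma cvg_realC (T : Type) (F : set_system T) {FF : Filter F} (f : T -> R) (l : R) :
  f @ F --> l -> (fun x => (f x)%:C : R[i]^o) @ F --> (l%:C : R[i]^o).
Proof.
move=> /cvgrPdist_le fl; apply/cvg_realP => e e0.
have := fl e e0; apply: filterS => x.
rewrite -rmorphB /=.
have -> : `|(l - f x)%:C : R[i]^o| = `|l - f x|%:C.
  by rewrite [LHS]normc_def /= expr0n addr0 sqrtr_sqr.
by rewrite lecR.
Qed.

Lemma cvg_conjC (T : Type) (F : set_system T) {FF : Filter F} (f : T -> R[i]^o)
    (l : R[i]^o) :
  f @ F --> l -> (fun x => (f x)^* : R[i]^o) @ F --> (l^* : R[i]^o).
Proof.
move=> /cvg_realP fl; apply/cvg_realP => e e0.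
have := fl e e0; apply: filterS => x; rewrite -rmorphB.
by rewrite [X in _ -> X <= _](@norm_conjC R[i]).
Qed.

(** Both coordinates are 1-Lipschitz, so completeness of [R] applies to each. *)
Lemma complex_cauchy_cvg (T : Type) (F : set_system T) {FF : ProperFilter F}
    (f : T -> R[i]^o) :
  (forall e : R, 0 < e ->
     exists a : R[i], \forall x \near F, Normc.normc (a - f x) <= e) ->
  exists l : R[i]^o, f @ F --> l.
Proof.
move=> Fc.
have coord_cvg (p : R[i] -> R) : (forall a x, `|p a - p x| <= Normc.normc (a - x)) ->
    cvg (p (f x) @[x --> F]).
  move=> pL; apply/cauchy_cvgP/cauchy_exP => e e0.
  have [a aF] := Fc (e / 2) ltac:(by rewrite divr_gt0).
  exists (p a); rewrite /= /nbhs /=; apply: filterS aF => x ax; rewrite /ball /=.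
  rewrite (le_lt_trans (pL _ _)) // (le_lt_trans ax) //.
  by rewrite ltr_pdivrMr // ltr_pMr // ltr1n.
have ReL (a x : R[i]) : `|complex.Re a - complex.Re x| <= Normc.normc (a - x).
  case: a x => a b [a' b'] /=; rewrite -sqrtr_sqr ler_wsqrtr //.
  by rewrite lerDl sqr_ge0.
have ImL (a x : R[i]) : `|complex.Im a - complex.Im x| <= Normc.normc (a - x).
  case: a x => a b [a' b'] /=; rewrite -sqrtr_sqr ler_wsqrtr //.
  by rewrite lerDr sqr_ge0.
have s := cvgD (@cvg_realC _ F _ _ _ (coord_cvg _ ReL))
  (cvgM (cvg_cst ('i%C : R[i]^o)) (@cvg_realC _ F _ _ _ (coord_cvg _ ImL))).
have -> : f = (fun x => (complex.Re (f x))%:C + 'i%C * (complex.Im (f x))%:C).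
  by apply/funext => x; exact: complexE.
by eexists; exact: s.
Qed.

End ComplexLimits.

(** * The Riesz vectors of an antilinear functional *)

Section RieszVectors.
Context {R : realType} {V : lmodType R[i]} (d : {dot V for conjC}).
Implicit Types (xi eta : antidual V) (zeta : bdual d) (M N : fdsub V) (v z : V).

Lemma fdsub_lin M a u v : fdsub_set M u -> fdsub_set M v -> fdsub_set M (a *: u + v).
Proof.
by move=> Mu Mv; have [[_ ML] _] := fdsubP M; apply/set_mem/ML; exact/mem_set.
Qed.

Lemma fdsub_extend M z :
  exists N, fdsub_set M `<=` fdsub_set N /\ fdsub_set N z.
Proof.
have [_ [s Ms]] := fdsubP M.
have P : finite_dim_subspace (lspan (z :: s)).
  by split; [exact: lspan_closed | exists (z :: s)].
have s0 : lspan s 0 by have [/set_mem] := lspan_closed s.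
exists (FDSub P); split=> /= [v|].
  by rewrite Ms => sv; apply/lspan_cons; exists 0, v; rewrite scale0r add0r.
by apply/lspan_cons; exists 1, 0; rewrite scale1r addr0.
Qed.

Lemma fdsub_up_mem v : \forall M \near fdsub_up V, fdsub_set M v.
Proof.
have [M0 _] := filter_ex (@filterT _ (fdsub_up V) _).
have [M [_ Mv]] := fdsub_extend M0 v.
by exists M => // N; exact.
Qed.

Lemma riesz_lin a xi eta M :
  riesz d (a *: xi + eta) M = a *: riesz d xi M + riesz d eta M.
Proof.
have [Mx xP] := rieszP d xi M; have [Me eP] := rieszP d eta M.
apply/esym/riesz_unique; first exact: fdsub_lin.
move=> z Mz; rewrite braketDr braketZr -xP // -eP //.
Qed.

Lemma riesz_antidual_of v M : fdsub_set M v -> riesz d (antidual_of d v) M = v.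
Proof. by move=> Mv; apply/esym/riesz_unique. Qed.

Lemma ipnorm_sqrE v : ((ipnorm d v) ^+ 2)%:C = braket d v v.
Proof. by rewrite rmorphXn /= ipnormE. Qed.

(** The vector for [M] is orthogonal to the difference of the two vectors, since
    [xi] evaluated at it is its inner product with either of them. *)
Lemma riesz_pythagoras xi M N : fdsub_set M `<=` fdsub_set N ->
  ipnorm d (riesz d xi N) ^+ 2 =
  ipnorm d (riesz d xi M) ^+ 2 + ipnorm d (riesz d xi N - riesz d xi M) ^+ 2.
Proof.
move=> MN; have [Mx xM] := rieszP d xi M; have [Nx xN] := rieszP d xi N.
have e : braket d (riesz d xi M) (riesz d xi N) =
         braket d (riesz d xi M) (riesz d xi M).
  by rewrite -xN ?xM //; exact: MN.
have eC : braket d (riesz d xi N) (riesz d xi M) =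
         braket d (riesz d xi M) (riesz d xi M).
  by rewrite braketC e -braketC.
apply: (@complexI R); rewrite rmorphD /= !ipnorm_sqrE.
rewrite -[- riesz _ _ _]scaleN1r braketDl !braketDr !braketZl !braketZr e eC.
by rewrite rmorphN1 !mulN1r subrr addr0 addrC subrK.
Qed.

Lemma ipnorm_riesz_ge xi M z : fdsub_set M z ->
  Normc.normc (xi z) <= ipnorm d (riesz d xi M) * ipnorm d z.
Proof.
move=> Mz; have [_ ->//] := rieszP d xi M.
by rewrite mulrC; exact: braket_CauchySchwarz.
Qed.

(** Evaluate [zeta] at its own Riesz vector [w]: the value is the squared norm
    of [w], and it is at most [opnorm zeta] times the norm of [w]. *)
Lemma ipnorm_riesz_le zeta M : ipnorm d (riesz d zeta M) <= opnorm zeta.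
Proof.
set w := riesz d zeta M.
have := opnorm_ge zeta w.
have [Mw /(_ _ Mw) ->] := rieszP d zeta M; rewrite -/w -ipnorm_sqrE.
rewrite /= expr0n addr0 sqrtr_sqr normrX ger0_norm ?ipnorm_ge0 // expr2.
have [->|w0] := eqVneq (ipnorm d w) 0; first by rewrite opnorm_ge0.
by rewrite ler_pM2r // lt_def w0 ipnorm_ge0.
Qed.

(** At [z] in the unit ball, enlarge [M] to some [N] containing [z]: there the
    functional is the inner product with the difference of the Riesz vectors
    for [N] and [M], whose norm is given by Pythagoras. *)
Lemma opnorm_sub_riesz zeta M :
  opnorm (zeta - bdual_of d (riesz d zeta M)) ^+ 2 <=
  opnorm zeta ^+ 2 - ipnorm d (riesz d zeta M) ^+ 2.
Proof.
set w := riesz d zeta M.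
have D0 : 0 <= opnorm zeta ^+ 2 - ipnorm d w ^+ 2.
  by rewrite subr_ge0 lerXn2r ?nnegrE ?ipnorm_ge0 ?opnorm_ge0 ?ipnorm_riesz_le.
rewrite -[leRHS]sqr_sqrtr // lerXn2r ?nnegrE ?opnorm_ge0 ?sqrtr_ge0 //.
apply: opnorm_le => z z1.
have [N [MN Nz]] := fdsub_extend M z.
rewrite [X in Normc.normc X](_ : _ = braket d z (riesz d zeta N - w)); last first.
  by rewrite braketBr; have [_ <-] := rieszP d zeta N.
rewrite (le_trans (braket_CauchySchwarz _ _ _)) //.
rewrite (le_trans (ler_piMl (ipnorm_ge0 _ _) z1)) //.
rewrite -[leLHS]ger0_norm ?ipnorm_ge0 // -sqrtr_sqr ler_wsqrtr //.
rewrite lerBrDl -riesz_pythagoras //.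
by rewrite lerXn2r ?nnegrE ?ipnorm_ge0 ?opnorm_ge0 ?ipnorm_riesz_le.
Qed.

(** A [z] in the unit ball nearly attaining the operator norm lies in all large
    [M], and
    Cauchy-Schwarz in [M] bounds the norm of the Riesz vector from below. *)
Lemma ipnorm_riesz_cvg zeta :
  ipnorm d (riesz d zeta M) @[M --> fdsub_up V] --> opnorm zeta.
Proof.
apply/cvgrPdist_le => e e0.
have [_ [z z1 <-]] := sup_adherent e0 (opnorm_has_sup zeta).
rewrite -/(opnorm zeta) => ze.
near=> M; rewrite ger0_norm ?subr_ge0 ?ipnorm_riesz_le //.
rewrite lerBlDr -lerBlDl; apply/ltW/(lt_le_trans ze).
have Mz : fdsub_set M z by near: M; exact: fdsub_up_mem.
by rewrite (le_trans (ipnorm_riesz_ge _ Mz)) // ler_piMr ?ipnorm_ge0.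
Unshelve. all: by end_near.
Qed.

Lemma riesz_cvg zeta : bdual_of d (riesz d zeta M) @[M --> fdsub_up V] --> zeta.
Proof.
apply/cvg_realP => e e0.
have : ipnorm d (riesz d zeta M) ^+ 2 @[M --> fdsub_up V] --> opnorm zeta ^+ 2.
  by apply: cvgM; exact: ipnorm_riesz_cvg.
move=> /cvgrPdist_le/(_ (e ^+ 2)); rewrite exprn_gt0 // => /(_ isT).
apply: filterS => M; rewrite bdual_normE lecR => le_e.
rewrite -(@ler_pXn2r _ 2) ?nnegrE ?opnorm_ge0 ?(ltW e0) //.
rewrite (le_trans (opnorm_sub_riesz _ _)) // (le_trans _ le_e) //.
exact: ler_norm.
Qed.

Lemma braket_polarization u v :
  4 * braket d u v = \sum_(n < 4) 'i ^- n * (ipnorm d (u + 'i ^+ n *: v) ^+ 2)%:C.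
Proof.
have ii : 'i * 'i = -1 :> R[i] by rewrite -expr2 sqrCi.
under eq_bigr do
  rewrite ipnorm_sqrE braketDl !braketDr !braketZl !braketZr !rmorphXn /= conjCi.
rewrite !big_ord_recr big_ord0 /= -!exprVn invCi.
ring: ii.
Qed.

Lemma pip_net_polarization xi eta M :
  4 * pip_net d xi eta M =
  \sum_(n < 4) 'i ^- n * (ipnorm d (riesz d (xi + 'i ^+ n *: eta) M) ^+ 2)%:C.
Proof.
rewrite /pip_net braket_polarization; apply: eq_bigr => n _.
by rewrite addrC [xi + _]addrC riesz_lin.
Qed.

End RieszVectors.

(** * The partial inner product of bounded functionals *)

Section InnerProductOnBoundedDual.
Context {R : realType} {V : lmodType R[i]} (d : {dot V for conjC}).
Implicit Types (xi eta zeta : bdual d) (M N : fdsub V) (v z : V).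

(** The limit is written as the polarization formula, because only the norms of
    Riesz vectors are known to converge at this point. *)
Lemma pip_net_cvg xi eta :
  pip_net d xi eta @ fdsub_up V -->
  (4^-1 * \sum_(n < 4) 'i ^- n * (opnorm (xi + 'i ^+ n *: eta) ^+ 2)%:C : R[i]^o).
Proof.
have -> : pip_net d xi eta = fun M => 4^-1 *
    \sum_(n < 4) 'i ^- n * (ipnorm d (riesz d (xi + 'i ^+ n *: eta) M) ^+ 2)%:C.
  by apply/funext => M; rewrite -pip_net_polarization mulKf // pnatr_eq0.
apply: (cvgM (cvg_cst _)).
apply: (@cvg_big R[i]^o) => [|n _]; first exact: add_continuous.
apply: (cvgM (cvg_cst _)); apply: cvg_realC.
by apply: cvgM; exact: (ipnorm_riesz_cvg (zeta := xi + 'i ^+ n *: eta)).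
Qed.

Lemma pip_definedP xi eta : pip_defined d xi eta.
Proof. by apply/cvg_ex; eexists; exact: pip_net_cvg. Qed.

Lemma pip_eq xi eta (l : R[i]^o) : pip_net d xi eta @ fdsub_up V --> l ->
  pip d xi eta = l.
Proof. by move=> /cvg_lim; apply; exact: norm_hausdorff. Qed.

Lemma pip_cvg xi eta : pip_net d xi eta @ fdsub_up V --> (pip d xi eta : R[i]^o).
Proof. exact: pip_definedP. Qed.

Lemma pip_polarization xi eta :
  4 * pip d xi eta = \sum_(n < 4) 'i ^- n * (opnorm (xi + 'i ^+ n *: eta) ^+ 2)%:C.
Proof. by rewrite (pip_eq (@pip_net_cvg xi eta)) mulVKf // pnatr_eq0. Qed.

Lemma pipC xi eta : pip d eta xi = (pip d xi eta)^*.
Proof.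
apply: pip_eq; have -> : pip_net d eta xi = fun M => (pip_net d xi eta M)^*.
  by apply/funext => M; rewrite /pip_net braketC.
by apply: cvg_conjC; exact: pip_cvg.
Qed.

Lemma pip_linr a xi eta zeta :
  pip d zeta (a *: xi + eta) = a * pip d zeta xi + pip d zeta eta.
Proof.
apply: pip_eq; have -> : pip_net d zeta (a *: xi + eta) =
    fun M => a * pip_net d zeta xi M + pip_net d zeta eta M.
  apply/funext => M; rewrite /pip_net.
  by rewrite -[RHS]/(_ * braket d _ _ + _) -braketZr -braketDr -riesz_lin.
by apply: cvgD; [apply: (cvgM (cvg_cst _))|]; exact: pip_cvg.
Qed.

Lemma pip_linl a xi eta zeta :
  pip d (a *: xi + eta) zeta = a^* * pip d xi zeta + pip d eta zeta.
Proof. by rewrite pipC pip_linr rmorphD rmorphM /= -!pipC. Qed.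

Lemma pip_norm zeta : pip d zeta zeta = (opnorm zeta ^+ 2)%:C.
Proof.
apply: pip_eq; have -> : pip_net d zeta zeta =
    fun M => (ipnorm d (riesz d zeta M) ^+ 2)%:C.
  by apply/funext => M; rewrite ipnorm_sqrE.
by apply: cvg_realC; apply: cvgM; exact: ipnorm_riesz_cvg.
Qed.

(** The net is eventually constant: as soon as [M] contains [u] and [v], these
    are their own Riesz vectors. *)
Lemma pip_bdual_of u v : pip d (bdual_of d u) (bdual_of d v) = braket d u v.
Proof.
apply: pip_eq; apply: cvg_near_cst; near=> M.
have Mu : fdsub_set M u by near: M; exact: fdsub_up_mem.
have Mv : fdsub_set M v by near: M; exact: fdsub_up_mem.
by rewrite /pip_net !riesz_antidual_of.
Unshelve. all: by end_near.
Qed.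

(** The arguments are exchanged: forms are linear in the first argument, and
    [pip] in the second. *)
Definition pipform (eta xi : bdual d) : R[i] := pip d xi eta.

Lemma pipform_bilinear :
  bilinear_for ( *%R : GRing.Scale.law R[i] R[i])
    ((@conjC R[i]) \; *%R : GRing.Scale.law R[i] R[i]) pipform.
Proof.
split=> [xi a u v|eta a u v]; first exact: pip_linr.
exact: pip_linl.
Qed.

HB.instance Definition _ := bilinear_isBilinear.Build R[i] (bdual d) (bdual d) R[i]
  _ _ pipform pipform_bilinear.

Lemma pipform_hermitian eta xi : pipform eta xi = (-1) ^+ false * (pipform xi eta)^*.
Proof. by rewrite mul1r /pipform pipC. Qed.

HB.instance Definition _ := isHermitianSesquilinear.Build R[i] (bdual d) false
  (@conjC R[i]) pipform pipform_hermitian.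

Lemma pipform_gt0 zeta : zeta != 0 -> 0 < pipform zeta zeta.
Proof.
move=> z0; rewrite /pipform pip_norm ltcR exprn_gt0 // lt_def opnorm_ge0 andbT.
by apply: contra z0 => /eqP/opnorm_eq0 ->.
Qed.

HB.instance Definition _ := isDotProduct.Build R[i] (bdual d) pipform pipform_gt0.

Definition pipdot : {dot bdual d for conjC} := pipform.

Lemma ipnorm_pipdot zeta : ipnorm pipdot zeta = opnorm zeta.
Proof.
by rewrite /ipnorm /braket /= /pipform pip_norm /= sqrtr_sqr ger0_norm ?opnorm_ge0.
Qed.

End InnerProductOnBoundedDual.

(** * Completeness of the bounded antidual *)

Section Completeness.
Context {R : realType} {V : lmodType R[i]} (d : {dot V for conjC}).

Lemma opnorm_distC (f g : bdual d) : opnorm (f - g) = opnorm (g - f).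
Proof. by apply: (@complexI R); exact: (distrC f g). Qed.

Lemma bdual_eval (f g : bdual d) z :
  Normc.normc (f z - g z) <= opnorm (f - g) * ipnorm d z.
Proof. exact: (opnorm_ge (f - g) z). Qed.

(** The limit is the pointwise limit [l] of the filter. A functional [f] within
    [e] of almost all of the filter is also within [e] of [l]; this shows both
    that [l] is bounded and that the filter converges to it in norm. *)
Lemma bdual_complete (F : set_system (bdual d)) :
  ProperFilter F -> cauchy F -> cvg F.
Proof.
move=> FF Fc.
have near_center (e : R) : 0 < e ->
    exists f : bdual d, \forall g \near F, opnorm (f - g) <= e.
  move=> e0; have := (@cauchyP _ _ F FF).1 Fc e%:C.
  rewrite ltcR => /(_ e0)[f Ff]; exists f; apply: filterS Ff => g.
  by rewrite -ball_normE /= bdual_normE ltcR => /ltW.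
have pointwise z : exists l : R[i]^o, (f : bdual d) z @[f --> F] --> l.
  apply: complex_cauchy_cvg => e e0.
  (* The norm of [z] may vanish; adding 1 makes it positive, so that it
     can divide [e]. *)
  have p0 : 0 < ipnorm d z + 1 by rewrite ltr_wpDl // ipnorm_ge0.
  have [f Ff] := near_center (e / (ipnorm d z + 1)) ltac:(by rewrite divr_gt0).
  exists (f z); apply: filterS Ff => g fg.
  rewrite (le_trans (bdual_eval _ _ _)) //.
  rewrite (le_trans (ler_wpM2r (ipnorm_ge0 _ _) fg)) //.
  by rewrite mulrAC ler_pdivrMr // ler_pM2l // lerDl.
have [l lP] := choice pointwise.
have l_anti : antilinear l.
  move=> a u v.
  have lin_cvg : (f : bdual d) (a *: u + v) @[f --> F] -->
      (a^* * l u + l v : R[i]^o).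
    have -> : (fun f : bdual d => (f : bdual d) (a *: u + v)) =
        (fun f : bdual d => a^* * f u + f v : R[i]^o).
      by apply/funext => f; exact: antidualE.
    exact: cvgD (cvgM (cvg_cst (a^* : R[i]^o)) (lP u)) (lP v).
  have hd := @norm_hausdorff _ R[i]^o.
  exact (cvg_unique hd (lP _) lin_cvg).
have near_lim (e : R) (f : bdual d) z : (\forall g \near F, opnorm (f - g) <= e) ->
    Normc.normc (l z - f z) <= e * ipnorm d z.
  move=> Ff; apply/ler_addgt0Pr => t t0.
  have lz : \forall g \near F, `|l z - (g : bdual d) z| <= t%:C.
    exact: (@cvg_realP R R[i]^o _ F _ (fun g : bdual d => g z) (l z)).1 (lP z) t t0.
  have [g [fg lg]] := filter_ex (filterI Ff lz).
  rewrite -(subrKA (g z)) addrC (le_trans (le_normcD _ _)) // lerD //.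
    rewrite (le_trans (bdual_eval _ _ _)) // opnorm_distC.
    by rewrite ler_wpM2r // ipnorm_ge0.
  by move: lg; rewrite lecR.
have l_bounded : Antidual (asboolT l_anti) \in bounded_pred d.
  have [f Ff] := near_center 1 ltac:(by []).
  apply/asboolP; exists (1 + opnorm f) => z /=.
  rewrite -(subrK (f z) (l z)) mulrDl (le_trans (le_normcD _ _)) //.
  by rewrite lerD ?opnorm_ge //; exact: near_lim.
apply/cvg_ex; exists (Bdual l_bounded); apply/cvg_realP => e e0.
have [f Ff] := near_center (e / 2) ltac:(by rewrite divr_gt0).
apply: filterS (Ff) => g fg; rewrite bdual_normE lecR.
rewrite -(subrKA f) (le_trans (opnormD _ _)) // [leRHS]splitr lerD //.
apply: opnorm_le => z z1; rewrite (le_trans (near_lim _ _ _ Ff)) //.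
by rewrite ler_piMr // divr_ge0 // ltW.
Qed.

End Completeness.

(** * The Hilbert space completion *)

Section HilbertCompletion.
Context {R : realType} {V : lmodType R[i]} (d : {dot V for conjC}).

Lemma bdual_of_linear : linear (bdual_of d).
Proof.
move=> a u v; do 2!apply: val_inj; apply/funext => z.
by rewrite /= braketDr braketZr.
Qed.

(** Every [zeta] is the limit of the functionals [zeta_M'], which come from
    vectors of [V]. *)
Lemma bdual_of_dense : dense (range (bdual_of d)).
Proof.
move=> O [zeta Oz] Oo.
have On : \forall M \near fdsub_up V, O (bdual_of d (riesz d zeta M)).
  by apply: (@riesz_cvg _ _ d zeta); exact: open_nbhs_nbhs.
have [M OM] := filter_ex On.
by exists (bdual_of d (riesz d zeta M)); split=> //; exists (riesz d zeta M).
Qed.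

Lemma bdual_hilbert_completion : hilbert_completion d (pipdot d) (bdual_of d).
Proof.
split.
- by move=> zeta; rewrite bdual_normE ipnorm_pipdot.
- exact: bdual_complete.
- exact: bdual_of_linear.
- by move=> u v; exact: pip_bdual_of.
- exact: bdual_of_dense.
Qed.

End HilbertCompletion.

Theorem mainTheorem2 (R : realType) (V : lmodType R[i])
    (d : {dot V for conjC}) (Vinf : infinite_dimensional V) :
  (forall xi eta : bdual d,
     pip_defined d xi eta /\
     4 * pip d xi eta =
       \sum_(n < 4) 'i ^- n * (opnorm (xi + 'i ^+ n *: eta) ^+ 2)%:C) /\
  (exists D : {dot bdual d for conjC},
     [/\ forall xi eta : bdual d, braket D xi eta = pip d xi eta,
         forall zeta : bdual d, ipnorm D zeta = opnorm zeta
       & hilbert_completion d D (bdual_of d)]) /\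
  (forall zeta : bdual d,
     bdual_of d (riesz d zeta M) @[M --> fdsub_up V] --> zeta).
Proof.
split; [|split].
- by move=> xi eta; split; [exact: pip_definedP | exact: pip_polarization].
- exists (pipdot d); split=> //; first exact: ipnorm_pipdot.
  exact: bdual_hilbert_completion.
- exact: riesz_cvg.
Qed.
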